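(* Let $(\mathsf K,\mathsf D)$ be a differential ring and $n\ge2$. Consider monic operators $L=\sum_{i=0}^n\binom ni a_i\mathsf D^{n-i}$ ($a_0=1$). A noncommutative polynomial in the symbols $\Delta_{a_1}^m(I_k)$ ($2\le k\le n$, $m\ge0$) is a $\mathsf K$-valued gauge covariant; conversely, every $\mathsf K$-valued gauge covariant $C$ of order-$n$ operators is a noncommutative polynomial in the elements $\Delta_{a_1}^m(I_k)$, $2\le k\le n$, $m\ge0$. Equivalently, the set of $\mathsf K$-valued gauge covariants equals the differential subalgebra generated by $I_2,\dots,I_n$ under $\Delta_{a_1}$.
   Context: $(\mathsf K,\mathsf D)$: unital associative (possibly noncommutative) ring with derivation; $\mathsf K\langle\mathsf D\rangle$: Ore algebra, $\mathsf D a=a\mathsf D+\mathsf D(a)$. $I_2,\dots,I_n$ are the unique elements with $L=\nabla^n+\sum_{k=2}^n\binom nk I_k\nabla^{n-k}$, $\nabla=\mathsf D+a_1$. $\Delta_{a_1}(b):=\mathsf D(b)+a_1b-ba_1$. For $f$ invertible, $L^f:=f^{-1}Lf$. A $\mathsf K$-valued gauge covariant is a noncommutative differential polynomial $C=C(L)$ in the coefficients $a_i$ of $L$ and their $\mathsf D$-derivatives such that, for every differential extension of $\mathsf K$ and every invertible $f$ in it, $C(L^f)=f^{-1}C(L)f$. *)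

(* Defs.v *)
From HB Require Import structures.
From mathcomp Require Import all_boot all_order all_algebra.
Set Implicit Arguments. Unset Strict Implicit. Unset Printing Implicit Defensive.
Import GRing.Theory.
Local Open Scope ring_scope.

Definition is_derivation (R : pzRingType) (d : R -> R) : Prop :=
  (forall x y, d (x + y) = d x + d y) /\
  (forall x y, d (x * y) = d x * y + x * d y).

(* Formal expressions in the (noncommuting) symbols of type V, built from
   0, 1, +, -, *.  Their values in a ring are noncommutative polynomials with
   coefficients in Z. *)
Inductive ncexpr (V : Type) : Type :=
| NVar of V
| N0
| N1
| NAdd of ncexpr V & ncexpr V
| NOpp of ncexpr V
| NMul of ncexpr V & ncexpr V.
Arguments N0 {V}. Arguments N1 {V}.

Fixpoint neval (V : Type) (R : pzRingType) (env : V -> R) (e : ncexpr V) : R :=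
  match e with
  | NVar v => env v
  | N0 => 0
  | N1 => 1
  | NAdd e1 e2 => neval env e1 + neval env e2
  | NOpp e1 => - neval env e1
  | NMul e1 e2 => neval env e1 * neval env e2
  end.

Fixpoint nsubst (V W : Type) (s : V -> ncexpr W) (e : ncexpr V) : ncexpr W :=
  match e with
  | NVar v => s v
  | N0 => N0
  | N1 => N1
  | NAdd e1 e2 => NAdd (nsubst s e1) (nsubst s e2)
  | NOpp e1 => NOpp (nsubst s e1)
  | NMul e1 e2 => NMul (nsubst s e1) (nsubst s e2)
  end.

(* The symbol (i, m) stands for D^m(a_i).  The operator is
   L = sum_{i=0}^n binom(n,i) a_i D^(n-i), with a_0 = 1. *)
Definition dpoly := ncexpr (nat * nat).

(* coefficient a_i of L from a coefficient sequence a (only a_1..a_n matter;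
   a_0 = 1, and indices > n are not coefficients of L, set to 0). *)
Definition coef (R : pzRingType) (n : nat) (a : nat -> R) (i : nat) : R :=
  if i == 0%N then 1 else if (i <= n)%N then a i else 0.

Definition deval (R : pzRingType) (d : R -> R) (n : nat) (a : nat -> R)
  (C : dpoly) : R :=
  neval (fun v : nat * nat => iter v.2 d (coef n a v.1)) C.

Fixpoint dder (e : dpoly) : dpoly :=
  match e with
  | NVar v => NVar (v.1, v.2.+1)
  | N0 => N0
  | N1 => N0
  | NAdd e1 e2 => NAdd (dder e1) (dder e2)
  | NOpp e1 => NOpp (dder e1)
  | NMul e1 e2 => NAdd (NMul (dder e1) e2) (NMul e1 (dder e2))
  end.

Definition Delta (b : dpoly) : dpoly :=
  let a1 : dpoly := NVar (1%N, 0%N) in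
  NAdd (dder b) (NAdd (NMul a1 b) (NOpp (NMul b a1))).

Definition inv_symbol (n : nat) (I : nat -> dpoly) (v : nat * nat) : dpoly :=
  if (2 <= v.1 <= n)%N then iter v.2 Delta (I v.1) else N0.

Definition poly_in_invariants (n : nat) (I : nat -> dpoly)
  (Q : ncexpr (nat * nat)) : dpoly := nsubst (inv_symbol n I) Q.

(* an operator sum_k p_k D^k is represented by the sequence p (index k);
   operators are compared coefficientwise via nth 0. *)
Definition opmul (R : pzRingType) (d : R -> R) (p q : seq R) : seq R :=
  mkseq (fun k =>
    \sum_(i < size p) \sum_(j < size q) \sum_(m < i.+1)
       (if (i - m + j == k)%N then (p`_i * iter m d q`_j) *+ 'C(i, m) else 0))
    (size p + size q).

Definition opexp (R : pzRingType) (d : R -> R) (p : seq R) (k : nat) : seq R :=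
  iter k (opmul d p) [:: 1].

Definition opL (R : pzRingType) (n : nat) (a : nat -> R) : seq R :=
  mkseq (fun k => coef n a (n - k) *+ 'C(n, n - k)) n.+1.

Definition nabla (R : pzRingType) (n : nat) (a : nat -> R) : seq R :=
  [:: coef n a 1; 1].

(* I_2..I_n are characterised (as in the paper) by the operator identity
   L = nabla^n + sum_{k=2}^n binom(n,k) I_k nabla^(n-k),
   required to hold identically, i.e. in every differential ring. *)
Definition invariants_spec (n : nat) (I : nat -> dpoly) : Prop :=
  forall (R : pzRingType) (d : R -> R), is_derivation d ->
  forall (a : nat -> R) (k : nat),
    (opL n a)`_k =
      (opexp d (nabla n a) n)`_k +
      \sum_(2 <= j < n.+1)
         (opmul d [:: deval d n a (I j) *+ 'C(n, j)] (opexp d (nabla n a) (n - j)))`_k.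

(* For f invertible with inverse g, L^f = g L f = sum_i binom(n,i) b_i D^(n-i)
   with b_i = sum_{j<=i} binom(i,j) g a_j D^(i-j)(f). *)
Definition gauge (R : pzRingType) (d : R -> R) (n : nat) (f g : R)
  (a : nat -> R) : nat -> R :=
  fun i => \sum_(j < i.+1) (g * coef n a j * iter (i - j) d f) *+ 'C(i, j).

Definition gauge_covariant (K : pzRingType) (D : K -> K) (n : nat)
  (C : dpoly) : Prop :=
  forall (E : pzRingType) (dE : E -> E) (iota : {rmorphism K -> E}),
    injective iota -> is_derivation dE ->
    (forall x, dE (iota x) = iota (D x)) ->
    forall f g : E, f * g = 1 -> g * f = 1 ->
    forall a : nat -> K,
      deval dE n (gauge dE n f g (iota \o a)) C
      = g * deval dE n (iota \o a) C * f.

(* Main.v *)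
Require Import Defs.
From HB Require Import structures.
From mathcomp Require Import all_boot all_order all_algebra zify.
From mathcomp.classical Require Import boolp functions.
Set Implicit Arguments. Unset Strict Implicit. Unset Printing Implicit Defensive.
Import GRing.Theory Num.Theory.
Local Open Scope ring_scope.

(* A gauge transformation is a triple product in a ring of series.
   Let H(R) be the ring of sequences in R with the binomial convolution product
   (Hurwitz series); x |-> (D^k x)_k =: taylor(x) is a ring morphism R -> H(R).
   If A = (a_i) and B = (b_i) are the coefficient sequences of L and L^f, then
   B = f^-1 A taylor(f).  With D^m = sum_k C(m,k) P_k nabla^(m-k), the sequence
   P = (P_k) transforms by P |-> taylor(f^-1) P f, so the entries of the product
   A P, which are 1, 0, I_2, ..., I_n, are covariant.

   Conversely, the shift is a derivation of H(K), taylor embeds (K, D) into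
   (H(K), shift), and there the equation f' = - a_1 f has an invertible solution.
   It gauges a_1 to 0, where Delta^m(I_k) = D^m(a_k); hence a covariant C agrees
   with the polynomial obtained from C by reading D^m(a_k) as Delta^m(I_k).

   The hypothesis on I determines only C(n,k) I_k.  The identification of I_k
   with (A P)_k is therefore made first on free variables, in the torsion-free
   ring of noncommutative power series over Z, where an identity between
   noncommutative polynomials implies the same identity in every ring. *)

(** * Derivations and Hurwitz series *)

Section Derivation.
Context (R : pzRingType) (d : R -> R) (Hd : is_derivation d).

Lemma derD x y : d (x + y) = d x + d y. Proof. exact: Hd.1. Qed.
Lemma derM x y : d (x * y) = d x * y + x * d y. Proof. exact: Hd.2. Qed.
Lemma der0 : d 0 = 0.
Proof. by apply: (addIr (d 0)); rewrite -derD !add0r. Qed.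
Lemma derN x : d (- x) = - d x.
Proof. by apply: (addIr (d x)); rewrite -derD !addNr der0. Qed.
Lemma der1 : d 1 = 0.
Proof. by apply: (addIr (d 1)); rewrite add0r -[in RHS](mulr1 1) derM mulr1 mul1r. Qed.
Lemma iter_der0 m : iter m d 0 = 0.
Proof. by elim: m => //= m ->; rewrite der0. Qed.
Lemma iter_der1 m : iter m d 1 = (m == 0%N)%:R.
Proof. by case: m => //= m; elim: m => [|m IH] /=; rewrite ?der1 // IH der0. Qed.
Lemma iter_derD m x y : iter m d (x + y) = iter m d x + iter m d y.
Proof. by elim: m => //= m ->; rewrite derD. Qed.
Lemma iter_derN m x : iter m d (- x) = - iter m d x.
Proof. by elim: m => //= m ->; rewrite derN. Qed.
Lemma iter_der_sum m J (r : seq J) (P : pred J) (F : J -> R) :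
  iter m d (\sum_(j <- r | P j) F j) = \sum_(j <- r | P j) iter m d (F j).
Proof. exact: (big_morph _ (iter_derD m) (iter_der0 m)). Qed.
End Derivation.

(* Sequences over [R] with the product (u v)_k = sum_j C(k,j) u_j v_(k-j)
   (lemma [hurwitz_mulE]), stated by the Leibniz rule for the shift. *)
Definition hurwitz (R : Type) : Type := nat -> R.

Definition shift (R : Type) (u : hurwitz R) : hurwitz R := fun k => u k.+1.

Fixpoint hmul (R : pzRingType) (u v : hurwitz R) (k : nat) : R :=
  if k is k'.+1 then hmul (shift u) v k' + hmul u (shift v) k'
  else u 0%N * v 0%N.

Definition hconst (R : pzRingType) (x : R) : hurwitz R :=
  fun k => if k is 0 then x else 0.

HB.instance Definition _ (R : pzRingType) := GRing.Zmodule.copy (hurwitz R) (nat -> R).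

Section HurwitzRing.
Context (R : pzRingType).
Implicit Types u v w : hurwitz R.

Lemma shiftD u v : shift (u + v) = shift u + shift v. Proof. by []. Qed.

Lemma hurwitzD u v k : (u + v) k = u k + v k. Proof. by []. Qed.

Lemma hmulDl k u v w : hmul (u + v) w k = hmul u w k + hmul v w k.
Proof.
elim: k u v w => [|k IH] u v w /=; first exact: mulrDl.
by rewrite shiftD !IH addrACA.
Qed.

Lemma hmulDr k u v w : hmul u (v + w) k = hmul u v k + hmul u w k.
Proof.
elim: k u v w => [|k IH] u v w /=; first exact: mulrDr.
by rewrite shiftD !IH addrACA.
Qed.

Lemma hmul0l k v : hmul 0 v k = 0.
Proof. by apply: (addIr (hmul 0 v k)); rewrite -hmulDl !add0r. Qed.

Lemma hmul0r k v : hmul v 0 k = 0.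
Proof. by apply: (addIr (hmul v 0 k)); rewrite -hmulDr !add0r. Qed.

Lemma shift_hconst x : shift (hconst x) = 0 :> hurwitz R. Proof. by []. Qed.

Lemma hconst_mulE x u k : hmul (hconst x) u k = x * u k.
Proof. by elim: k u => //= k IH u; rewrite shift_hconst hmul0l add0r IH. Qed.

Lemma mul_hconstE x u k : hmul u (hconst x) k = u k * x.
Proof. by elim: k u => //= k IH u; rewrite shift_hconst hmul0r addr0 IH. Qed.

(** Both triple products obey the Leibniz rule for [shift], so entry k+1 splits into three entries
    of index k. *)
Fact hmulA : associative (@hmul R : hurwitz R -> hurwitz R -> hurwitz R).
Proof.
move=> u v w; apply/funext => k; elim: k u v w => [|k IH] u v w /=.
  exact: mulrA.
have sh x y : shift (hmul x y) = (hmul (shift x) y : hurwitz R) + hmul x (shift y).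
  by [].
by rewrite !sh hmulDl hmulDr !IH addrA.
Qed.

Fact hmul1l : left_id (hconst 1) (@hmul R : hurwitz R -> hurwitz R -> hurwitz R).
Proof. by move=> u; apply/funext => k; rewrite hconst_mulE mul1r. Qed.

Fact hmul1r : right_id (hconst 1) (@hmul R : hurwitz R -> hurwitz R -> hurwitz R).
Proof. by move=> u; apply/funext => k; rewrite mul_hconstE mulr1. Qed.

Fact hmul_distl :
  left_distributive (@hmul R : hurwitz R -> hurwitz R -> hurwitz R) +%R.
Proof. by move=> u v w; apply/funext => k; rewrite hmulDl. Qed.

Fact hmul_distr :
  right_distributive (@hmul R : hurwitz R -> hurwitz R -> hurwitz R) +%R.
Proof. by move=> u v w; apply/funext => k; rewrite hmulDr. Qed.

HB.instance Definition _ := GRing.Zmodule_isPzRing.Build (hurwitz R)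
  hmulA hmul1l hmul1r hmul_distl hmul_distr.

Lemma hurwitzM u v k : (u * v) k = hmul u v k. Proof. by []. Qed.

Lemma hurwitzM0 u v : (u * v) 0%N = u 0%N * v 0%N. Proof. by []. Qed.

Lemma hurwitzN u k : (- u) k = - u k. Proof. by []. Qed.

Lemma shift1 : shift 1 = 0 :> hurwitz R. Proof. by []. Qed.

Lemma hurwitzMn u m k : (u *+ m) k = u k *+ m.
Proof. by elim: m => [|m IH]; rewrite ?mulr0n // !mulrS hurwitzD IH. Qed.

Lemma hurwitz_sum (J : Type) (r : seq J) (P : pred J) (F : J -> hurwitz R) k :
  (\sum_(j <- r | P j) F j) k = \sum_(j <- r | P j) F j k.
Proof. exact: (big_morph (fun u : hurwitz R => u k)). Qed.

Lemma shiftM u v : shift (u * v) = shift u * v + u * shift v. Proof. by []. Qed.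

Lemma shift_derivation : is_derivation (@shift R).
Proof. by split=> u v; rewrite ?shiftD ?shiftM. Qed.

Lemma iter_shiftE m u k : iter m (@shift R) u k = u (k + m)%N.
Proof. by elim: m k => [|m IH] k /=; rewrite ?addn0 // /shift IH addSnnS. Qed.

Lemma hconstM x y : hconst x * hconst y = hconst (x * y) :> hurwitz R.
Proof.
by apply/funext => k; rewrite hurwitzM hconst_mulE; case: k => //= _; rewrite mulr0.
Qed.

Lemma hurwitz_mulE u v k :
  (u * v) k = \sum_(j < k.+1) (u j * v (k - j)%N) *+ 'C(k, j).
Proof.
elim: k u v => [|k IH] u v.
  by rewrite big_ord1 /= bin0 mulr1n.
have -> : (u * v) k.+1 = (shift u * v) k + (u * shift v) k by [].
rewrite !IH [RHS]big_ord_recl /= bin0 subn0 mulr1n.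
under [in RHS]eq_bigr do rewrite /bump /= add1n subSS binS mulrnDr.
rewrite big_split /= [RHS]addrA [RHS]addrC; congr (_ + _).
rewrite big_ord_recl /= bin0 mulr1n subn0; congr (_ + _).
rewrite [RHS]big_ord_recr /= bin_small // mulr0n addr0.
by apply: eq_bigr => j _; rewrite /bump /= add1n /shift subnSK.
Qed.

End HurwitzRing.

(** * Taylor sequences *)

Definition taylor (R : Type) (d : R -> R) (x : R) : hurwitz R :=
  fun k => iter k d x.

Definition hmap (R : Type) (d : R -> R) (u : hurwitz R) : hurwitz R :=
  fun k => d (u k).

(* The coefficients of D^m = sum_k C(m,k) P_k nabla^(m-k), nabla = D + c. *)
Fixpoint pseq (R : pzRingType) (d : R -> R) (c : R) (k : nat) : R :=
  if k is k'.+1 then d (pseq d c k') - pseq d c k' * c else 1.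

Section Taylor.
Context (R : pzRingType) (d : R -> R) (Hd : is_derivation d).
Implicit Types (x c f g : R) (u v : hurwitz R).

Lemma shift_taylor x : shift (taylor d x) = taylor d (d x).
Proof. by apply/funext => k; rewrite /shift /taylor iterSr. Qed.

Lemma hmap_taylor x : hmap d (taylor d x) = taylor d (d x).
Proof. by apply/funext => k; rewrite /hmap /taylor -iterS iterSr. Qed.

Lemma hmapM u v : hmap d (u * v) = hmap d u * v + u * hmap d v.
Proof.
apply/funext => k; rewrite /hmap hurwitzD !hurwitzM.
elim: k u v => [|k IH] u v /=; first exact: derM.
by rewrite (derD Hd) !IH addrACA.
Qed.

Lemma hmap_hconst x : hmap d (hconst x) = hconst (d x).
Proof. by apply/funext => -[|k]; rewrite /hmap //= der0. Qed.

Lemma taylorM x y : taylor d (x * y) = taylor d x * taylor d y.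
Proof.
apply/funext => k; elim: k x y => [//|k IH] x y.
have sh z : taylor d z k.+1 = taylor d (d z) k by rewrite /taylor iterSr.
rewrite sh derM // hurwitzM /= -!hurwitzM !shift_taylor -!IH.
by rewrite /taylor iter_derD.
Qed.

Lemma taylorB x y : taylor d (x - y) = taylor d x - taylor d y.
Proof. by apply/funext => k; rewrite hurwitzD hurwitzN /taylor iter_derD // iter_derN. Qed.

Lemma taylor1 : taylor d 1 = 1.
Proof. by apply/funext => k; rewrite /taylor iter_der1 //; case: k. Qed.

(** The recursion of [pseq] becomes one equation between series: [shift] acts on the index, [hmap d]
    on the entries. Closed formulas for P can then be checked by differentiation. *)
Lemma pseq_uniq c u :
  u 0%N = 1 -> shift u = hmap d u - u * hconst c -> u = pseq d c.
Proof.
move=> h0 hS; apply/funext; elim=> [//|k IH] /=.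
have := congr1 (fun w => w k) hS; rewrite /= hurwitzD hurwitzN hurwitzM mul_hconstE.
by rewrite /shift /hmap IH.
Qed.

Lemma pseq0 : pseq d 0 = 1 :> hurwitz R.
Proof.
apply/esym/pseq_uniq => //; rewrite shift1.
have -> : hconst 0 = 0 :> hurwitz R by apply/funext => -[].
by rewrite mulr0 subr0 -taylor1 hmap_taylor der1 //; apply/funext => k; rewrite /taylor iter_der0.
Qed.

Lemma shift_pseq c :
  shift (pseq d c) = hmap d (pseq d c) - (pseq d c : hurwitz R) * hconst c.
Proof.
by apply/funext => k; rewrite hurwitzD hurwitzN hurwitzM mul_hconstE.
Qed.

(** On [taylor d g] the maps [shift] and [hmap d] agree, while on [hconst f] only [hmap d] yields a
    term, in [d f]; the summand [g * d f] of the new connection coefficient absorbs it. *)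
Lemma pseq_gauge c f g : f * g = 1 -> g * f = 1 ->
  pseq d (g * d f + g * c * f) = taylor d g * (pseq d c : hurwitz R) * hconst f.
Proof.
move=> fg gf; apply/esym/pseq_uniq.
  by rewrite hurwitzM mul_hconstE hurwitzM /= /taylor /= mulr1 gf.
rewrite !shiftM shift_hconst mulr0 addr0 shift_taylor shift_pseq.
rewrite !hmapM hmap_taylor hmap_hconst -[X in _ = _ - X]mulrA hconstM.
have -> : f * (g * d f + g * c * f) = d f + c * f.
  by rewrite mulrDr !mulrA fg !mul1r.
have -> : hconst (d f + c * f) = hconst (d f) + hconst c * hconst f :> hurwitz R.
  by rewrite hconstM; apply/funext => -[|k]; rewrite hurwitzD //= addr0.
rewrite [X in _ - X]mulrDr opprD addrA addrK.
by rewrite mulrBr addrA mulrBl !mulrA.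
Qed.

(** Such an f is killed by nabla = D + c, so in D^m = sum_k C(m,k) P_k nabla^(m-k) only the term k =
    m survives. *)
Lemma taylor_pseq c f : d f = - (c * f) ->
  taylor d f = (pseq d c : hurwitz R) * hconst f.
Proof.
move=> df; apply/funext => k; rewrite hurwitzM mul_hconstE.
elim: k => [|k IH]; first by rewrite mul1r.
by rewrite /taylor iterS -/(taylor d f k) IH derM // df mulrBl mulrN mulrA.
Qed.
End Taylor.

(** * Covariance *)

Section Evaluation.
Context (V : Type) (R : pzRingType).
Implicit Types (env : V -> R) (e : ncexpr V).

Lemma eq_neval env env' e : env =1 env' -> neval env e = neval env' e.
Proof. by move=> h; elim: e => //= [? -> ? ->|? ->|? -> ? ->]. Qed.

Lemma neval_nsubst (W : Type) (env : W -> R) (s : V -> ncexpr W) e :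
  neval env (nsubst s e) = neval (fun v => neval env (s v)) e.
Proof. by elim: e => //= [? -> ? ->|? ->|? -> ? ->]. Qed.

Lemma neval_conj env f g e : f * g = 1 -> g * f = 1 ->
  neval (fun v => g * env v * f) e = g * neval env e * f.
Proof.
move=> fg gf; elim: e => //= [|| e1 -> e2 ->|e ->|e1 -> e2 ->].
- by rewrite mulr0 mul0r.
- by rewrite mulr1.
- by rewrite mulrDr mulrDl.
- by rewrite mulrN mulNr.
- by rewrite !mulrA -(mulrA _ f g) fg mulr1.
Qed.

Lemma neval_rmorph (S : pzRingType) (h : {rmorphism R -> S}) env e :
  h (neval env e) = neval (h \o env) e.
Proof.
elim: e => //= [||? <- ? <-|? <-|? <- ? <-];
  by rewrite ?rmorph0 ?rmorph1 ?rmorphD ?rmorphN ?rmorphM.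
Qed.

Fixpoint nconv (F G : nat -> ncexpr V) (k : nat) : ncexpr V :=
  if k is k'.+1 then NAdd (nconv (fun i => F i.+1) G k') (nconv F (fun i => G i.+1) k')
  else NMul (F 0%N) (G 0%N).

Lemma neval_nconv env F G k :
  neval env (nconv F G k) = hmul (fun i => neval env (F i)) (fun i => neval env (G i)) k.
Proof. by elim: k F G => //= k IH F G; rewrite !IH. Qed.

End Evaluation.

Fixpoint npseq (k : nat) : dpoly :=
  if k is k'.+1 then NAdd (dder (npseq k')) (NOpp (NMul (npseq k') (NVar (1%N, 0%N))))
  else N1.

(* I_j = sum_i C(j,i) a_i P_(j-i). *)
Definition canonical_inv (j : nat) : dpoly := nconv (fun i => NVar (i, 0%N)) npseq j.

Section DifferentialEvaluation.
Context (R : pzRingType) (d : R -> R) (Hd : is_derivation d) (n : nat).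
Implicit Types (a b : nat -> R) (C : dpoly).

Lemma deval_dder a C : deval d n a (dder C) = d (deval d n a C).
Proof.
rewrite /deval; elim: C => //= [||e1 -> e2 ->|e ->|e1 -> e2 ->].
- by rewrite der0.
- by rewrite der1.
- by rewrite derD.
- by rewrite derN.
- by rewrite (derM Hd).
Qed.

Lemma deval_Delta a C : deval d n a (Delta C) =
  d (deval d n a C) + (coef n a 1 * deval d n a C - deval d n a C * coef n a 1).
Proof. by rewrite -deval_dder. Qed.

Lemma deval_canonical a j : deval d n a (canonical_inv j) =
  ((coef n a : hurwitz R) * pseq d (coef n a 1)) j.
Proof.
rewrite /deval neval_nconv hurwitzM; congr (hmul _ _ _).
apply/funext; elim=> [//|k /= <-]; congr (_ + _).
exact: deval_dder.
Qed.

Lemma eq_hmul (u u' v : hurwitz R) k : (forall i, (i <= k)%N -> u i = u' i) ->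
  (u * v) k = (u' * v) k.
Proof.
move=> h; rewrite !hurwitz_mulE; apply: eq_bigr => i _.
by rewrite h // -ltnS.
Qed.

(** The entrywise form of B = f^-1 A taylor(f). Above n the left side is 0 by convention while the
    product need not vanish; at index 0 the convention a_0 = 1 matches g f = 1. *)
Lemma coef_gauge a f g i : (i <= n)%N -> g * f = 1 ->
  coef n (gauge d n f g a) i = (hconst g * (coef n a : hurwitz R) * taylor d f) i.
Proof.
move=> lin gf; rewrite hurwitz_mulE.
under eq_bigr do rewrite hurwitzM hconst_mulE.
rewrite /coef; case: eqP => [->|_]; last by rewrite lin.
by rewrite big_ord1 mulr1 bin0 mulr1n.
Qed.

Lemma coef1_gauge a f g : (0 < n)%N -> g * f = 1 ->
  coef n (gauge d n f g a) 1 = g * d f + g * coef n a 1 * f.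
Proof.
move=> n0 gf; rewrite coef_gauge // hurwitz_mulE big_ord_recl big_ord1 /=.
by rewrite !hurwitzM !hconst_mulE mulr1.
Qed.

(* The generating identity B = g A taylor(f) and P(b) = taylor(g) P(a) f
   give B P(b) = g A P(a) f. *)
Lemma canonical_covariant a f g j : (0 < n)%N -> (j <= n)%N ->
  f * g = 1 -> g * f = 1 ->
  deval d n (gauge d n f g a) (canonical_inv j)
    = g * deval d n a (canonical_inv j) * f.
Proof.
move=> n0 jn fg gf; rewrite !deval_canonical coef1_gauge //.
rewrite (@eq_hmul _ (hconst g * (coef n a : hurwitz R) * taylor d f)); last first.
  by move=> i ij; apply: coef_gauge => //; apply: leq_trans ij jn.
rewrite pseq_gauge // !mulrA -(mulrA _ (taylor d f)) -taylorM // fg taylor1 // mulr1.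
by rewrite hurwitzM mul_hconstE -mulrA hurwitzM hconst_mulE.
Qed.

(** [Delta] is the commutator with nabla = D + a_1, and the gauge action conjugates nabla. *)
Lemma Delta_covariant a f g C : (0 < n)%N -> f * g = 1 -> g * f = 1 ->
  deval d n (gauge d n f g a) C = g * deval d n a C * f ->
  deval d n (gauge d n f g a) (Delta C) = g * deval d n a (Delta C) * f.
Proof.
move=> n0 fg gf hC; rewrite !deval_Delta hC coef1_gauge //.
set x := deval d n a C; set c := coef n a 1.
have dg : d g = - (g * d f * g).
  have /eqP := derM Hd g f; rewrite gf der1 // eq_sym addr_eq0 => /eqP h.
  by rewrite -[LHS]mulr1 -fg mulrA h mulNr.
rewrite !(derM Hd) dg.
have fgK y : y * f * g = y by rewrite -mulrA fg mulr1.
rewrite !(mulrDr, mulrDl, mulrN, mulNr, opprD, mulrA) ?fgK.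
(* [A] and [T], which come from differentiating g and f, cancel against the terms that [g * d f]
   contributes to the transformed a_1. *)
set A := g * d f * g * x * f; set T := g * x * d f.
rewrite -!addrA [T + _]addrCA [g * d x * f + (A + _)]addrCA addKr.
by congr (_ + _); rewrite addrCA addNKr.
Qed.

End DifferentialEvaluation.

(** * Noncommutative power series over the integers *)

Definition ncseries (V : Type) : Type := seq V -> int.

Definition lquot (V : Type) (v : V) (f : ncseries V) : ncseries V :=
  fun w => f (v :: w).

(* The Cauchy product (f g)(w) = sum over w = w1 w2 of f(w1) g(w2). *)
Fixpoint ncmul (V : Type) (f g : ncseries V) (w : seq V) : int :=
  if w is v :: w' then f [::] * g w + ncmul (lquot v f) g w' else f [::] * g [::].

HB.instance Definition _ (V : Type) := GRing.Zmodule.copy (ncseries V) (seq V -> int).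

Section NcSeries.
Context (V : eqType).
Implicit Types (f g h : ncseries V) (v : V) (w : seq V).

Lemma ncseriesD f g w : (f + g) w = f w + g w. Proof. by []. Qed.

Lemma lquotD v f g : lquot v (f + g) = lquot v f + lquot v g. Proof. by []. Qed.

Lemma ncmulDl w f g h : ncmul (f + g) h w = ncmul f h w + ncmul g h w.
Proof.
elim: w f g h => [|v w IH] f g h /=; first exact: mulrDl.
by rewrite lquotD IH ncseriesD mulrDl addrACA.
Qed.

Lemma ncmulDr w f g h : ncmul f (g + h) w = ncmul f g w + ncmul f h w.
Proof.
elim: w f g h => [|v w IH] f g h /=; first exact: mulrDr.
by rewrite IH ncseriesD mulrDr addrACA.
Qed.

Lemma ncmul0l w g : ncmul 0 g w = 0.
Proof. by apply: (addIr (ncmul 0 g w)); rewrite -ncmulDl !add0r. Qed.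

Definition ncscalar (c : int) : ncseries V := fun w => if w is [::] then c else 0.

Lemma ncscalar_mulE c f w : ncmul (ncscalar c) f w = c * f w.
Proof.
case: w => //= v w; have -> : lquot v (ncscalar c) = 0 by [].
by rewrite ncmul0l addr0.
Qed.

Fact ncmul1r : right_id (ncscalar 1) (@ncmul V : ncseries V -> ncseries V -> ncseries V).
Proof.
move=> f; apply/funext => w; elim: w f => [|v w IH] f /=; first by rewrite mulr1.
by rewrite IH mulr0 add0r.
Qed.

Fact ncmul1l : left_id (ncscalar 1) (@ncmul V : ncseries V -> ncseries V -> ncseries V).
Proof. by move=> f; apply/funext => w; rewrite ncscalar_mulE mul1r. Qed.

Lemma ncmul_scaler w c f g :
  ncmul (fun w => c * f w) g w = c * ncmul f g w.
Proof.
elim: w f => [|v w IH] f /=; first by rewrite mulrA.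
by rewrite mulrDr mulrA -IH.
Qed.

Fact ncmulA : associative (@ncmul V : ncseries V -> ncseries V -> ncseries V).
Proof.
move=> f g h; apply/funext => w; elim: w f g h => [|v w IH] f g h /=.
  exact: mulrA.
have -> : lquot v (ncmul f g) =
    ((fun w => f [::] * lquot v g w) : ncseries V) + ncmul (lquot v f) g by [].
by rewrite ncmulDl ncmul_scaler IH mulrDr !mulrA addrA.
Qed.

Fact ncmul_distl :
  left_distributive (@ncmul V : ncseries V -> ncseries V -> ncseries V) +%R.
Proof. by move=> f g h; apply/funext => w; rewrite ncmulDl. Qed.

Fact ncmul_distr :
  right_distributive (@ncmul V : ncseries V -> ncseries V -> ncseries V) +%R.
Proof. by move=> f g h; apply/funext => w; rewrite ncmulDr. Qed.

HB.instance Definition _ := GRing.Zmodule_isPzRing.Build (ncseries V)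
  ncmulA ncmul1l ncmul1r ncmul_distl ncmul_distr.

Definition ncvar v : ncseries V := fun w => (w == [:: v])%:Z.

Lemma ncvar_mulE v f w :
  (ncvar v * f) w = if w is v' :: w' then (v' == v)%:Z * f w' else 0.
Proof.
case: w => [|v' w] /=; first by rewrite -[LHS]/(0 * f [::]) mul0r.
rewrite -[LHS]/(0 * f (v' :: w) + ncmul (lquot v' (ncvar v)) f w) mul0r add0r.
have -> : lquot v' (ncvar v) = ncscalar (v' == v)%:Z.
  by apply/funext => -[|x y]; rewrite /lquot /ncvar eqseq_cons //= ?andbT ?andbF.
by rewrite ncscalar_mulE.
Qed.

Lemma prod_ncvarE w w' : (\prod_(v <- w) ncvar v) w' = (w' == w)%:Z.
Proof.
elim: w w' => [|v w IH] w'; first by rewrite big_nil; case: w'.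
rewrite big_cons ncvar_mulE; case: w' => [//|v' w'].
by rewrite IH eqseq_cons; do 2!case: eqP.
Qed.

Lemma ncseriesMz f (z : int) w : (f *~ z) w = f w *~ z.
Proof.
have nat_case (k : nat) : (f *+ k) w = f w *+ k.
  by elim: k => [|k IH]; rewrite ?mulr0n // !mulrS ncseriesD IH.
by case: z => k; rewrite ?NegzE ?mulrNz -?pmulrn -?[LHS]/(- ((f *+ k.+1) w)) nat_case.
Qed.

Lemma ncseries_sum (J : Type) (r : seq J) (F : J -> ncseries V) w :
  (\sum_(j <- r) F j) w = \sum_(j <- r) F j w.
Proof. exact: (big_morph (fun f : ncseries V => f w)). Qed.

Lemma ncseries_torsion_free f k : (0 < k)%N -> f *+ k = 0 -> f = 0.
Proof.
move=> k0 fk; apply/funext => w; have := congr1 (fun f : ncseries V => f w) fk.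
rewrite /= pmulrn ncseriesMz -pmulrn => /eqP; rewrite mulrn_eq0 eqn0Ngt k0 /=.
by move/eqP.
Qed.

(** The list of monomials is chosen before the ring, so coefficients found in one ring serve in all
    others. *)
Lemma neval_monomials (e : ncexpr V) : exists s : seq (seq V * int),
  forall (R : pzRingType) (env : V -> R),
    neval env e = \sum_(p <- s) (\prod_(v <- p.1) env v) *~ p.2.
Proof.
elim: e => [v|||e1 [s1 h1] e2 [s2 h2]|e [s h]|e1 [s1 h1] e2 [s2 h2]].
- by exists [:: ([:: v], 1)] => R env; rewrite !big_seq1.
- by exists [::] => R env; rewrite big_nil.
- by exists [:: ([::], 1)] => R env; rewrite big_seq1 big_nil.
- by exists (s1 ++ s2) => R env; rewrite big_cat /= h1 h2.
- exists [seq (p.1, - p.2) | p <- s] => R env; rewrite big_map /= h -sumrN.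
  by apply: eq_bigr => p _; rewrite mulrNz.
exists [seq (p.1 ++ q.1, p.2 * q.2) | p <- s1, q <- s2] => R env.
rewrite big_allpairs_dep /= h1 h2 big_distrl /=; apply: eq_bigr => p _.
rewrite big_distrr /=; apply: eq_bigr => q _.
by rewrite big_cat /= mulrzAl mulrzAr mulrzA mulrzAC.
Qed.

(** Products of the [ncvar] are indicators of words, so a vanishing value forces the total
    coefficient of each word to be 0; grouping the monomials by word then gives 0 in any ring. *)
Lemma ncvar_identity (e : ncexpr V) (R : pzRingType) (env : V -> R) :
  neval ncvar e = 0 -> neval env e = 0.
Proof.
have [s hs] := neval_monomials e; rewrite !hs => h0.
have coefE w : \sum_(p <- s | p.1 == w) p.2 = 0.
  have h0w := congr1 (fun f : ncseries V => f w) h0.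
  rewrite -[RHS]h0w ncseries_sum.
  rewrite big_mkcond /=; apply: eq_bigr => p _.
  rewrite ncseriesMz prod_ncvarE eq_sym.
  by case: eqP => _; rewrite ?intz ?mul0rz.
pose ws := undup (map fst s).
rewrite (eq_big_seq (fun p => \sum_(w <- ws | p.1 == w) (\prod_(v <- w) env v) *~ p.2)).
  rewrite (exchange_big_dep xpredT) //= big1 // => w _.
  by rewrite -mulrz_sumr coefE mulr0z.
move=> p ps; rewrite [RHS](eq_bigl (pred1 p.1)); last by move=> w; rewrite /= eq_sym.
by rewrite -[RHS]big_filter filter_pred1_uniq ?undup_uniq ?mem_undup ?map_f // big_seq1.
Qed.

End NcSeries.

(** * Identification of the invariants *)

Section Causal.
Context (R : pzRingType).
Implicit Types (u v : hurwitz R) (F : hurwitz R -> hurwitz R).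

(** This is the condition under which [shift u = F u] determines u recursively from its entry 0. *)
Definition causal F := forall u v k,
  (forall i, (i <= k)%N -> u i = v i) -> F u k = F v k.

Lemma causal_mulr c : causal (fun u => c * u).
Proof.
move=> u v k uv; rewrite !hurwitz_mulE; apply: eq_bigr => i _.
by rewrite uv // leq_subr.
Qed.

Lemma causal_mull c : causal (fun u => u * c).
Proof. by move=> u v k; apply: eq_hmul. Qed.

Lemma hurwitz_ode_uniq F u v : causal F -> u 0%N = v 0%N ->
  shift u = F u -> shift v = F v -> u = v.
Proof.
move=> cF uv0 hu hv; apply/funext => k.
elim/ltn_ind: k => -[//|k] IH.
rewrite -[u k.+1]/(shift u k) -[v k.+1]/(shift v k) hu hv.
by apply: cF => i ik; apply: IH.
Qed.

Lemma hurwitz_ode F x : causal F -> exists u, u 0%N = x /\ shift u = F u.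
Proof.
move=> cF; pose step u : hurwitz R := fun k => if k is k'.+1 then F u k' else x.
pose it N := iter N step 0.
(* Each pass through [step] settles one more entry, so entry k is final after k + 1 passes. *)
have stab k N M : (k < N)%N -> (k < M)%N -> it N k = it M k.
  elim/ltn_ind: k N M => -[|k] IH [//|N] [//|M] kN kM //=.
  by apply: cF => i ik; apply: IH => //; apply: leq_ltn_trans ik _.
exists (fun k => it k.+1 k); split=> //; apply/funext => k.
by apply: (cF (it k.+1)) => i ik; apply: stab.
Qed.

Lemma hurwitz_gauge c : exists f : hurwitz R, f 0%N = 1 /\ shift f = - (c * f).
Proof. by apply: (@hurwitz_ode (fun f => - (c * f))) => u v k /(causal_mulr c) h; rewrite !hurwitzN h. Qed.

(** The inverse is the solution of g' = g c with head 1. Then g f has derivative 0, while f g and 1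
    both solve u' = u c - c u; uniqueness settles each side. *)
Lemma hurwitz_gauge_inv (c f : hurwitz R) : f 0%N = 1 -> shift f = - (c * f) ->
  exists g : hurwitz R, f * g = 1 /\ g * f = 1.
Proof.
move=> f0 df; have [g [g0 dg]] := hurwitz_ode 1 (@causal_mull c).
have fg0 : (f * g) 0%N = 1 by rewrite hurwitzM /= f0 g0 mulr1.
have gf0 : (g * f) 0%N = 1 by rewrite hurwitzM /= f0 g0 mulr1.
exists g; split.
- apply: (@hurwitz_ode_uniq (fun u => u * c - c * u)) => //.
  + move=> u v k uv; rewrite !hurwitzD !hurwitzN.
    by rewrite (causal_mull c uv) (causal_mulr c uv).
  + by rewrite shiftM df dg mulNr !mulrA addrC.
  + by rewrite shift1 mulr1 mul1r subrr.
- apply: (@hurwitz_ode_uniq (fun=> 0)) => //.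
  by rewrite shiftM df dg mulrN mulrA subrr.
Qed.

End Causal.

(** * Differential operators acting on ring elements *)

Section OperatorAction.
Context (R : pzRingType) (d : R -> R) (Hd : is_derivation d).
Implicit Types (p q : seq R) (u x y : R).

Lemma iter_derM i x y :
  iter i d (x * y) = \sum_(m < i.+1) (iter m d x * iter (i - m) d y) *+ 'C(i, m).
Proof. by rewrite -[LHS]/(taylor d (x * y) i) taylorM // hurwitz_mulE. Qed.

Definition action p u : R := \sum_(i < size p) p`_i * iter i d u.

Lemma actionE N p u : (size p <= N)%N ->
  action p u = \sum_(i < N) p`_i * iter i d u.
Proof.
move=> pN; rewrite /action (big_ord_widen _ (fun i => p`_i * iter i d u) pN).
rewrite big_mkcond /=; apply: eq_bigr => i _.
by case: ltnP => // pi; rewrite nth_default // mul0r.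
Qed.

Lemma action_opmul p q u : action (opmul d p q) u = action p (action q u).
Proof.
rewrite /action size_mkseq.
under eq_bigr => k _.
  rewrite nth_mkseq // big_distrl /=.
  under eq_bigr => i _.
    rewrite big_distrl /=; under eq_bigr do rewrite big_distrl /=.
    over.
  over.
rewrite exchange_big /=; apply: eq_bigr => i _.
rewrite iter_der_sum // big_distrr exchange_big /=; apply: eq_bigr => j _.
rewrite iter_derM big_distrr exchange_big /=; apply: eq_bigr => m _.
(* The index i - m + j stays within the padded length of [opmul], so no term of the composition is
   cut off. *)
have lt : (i - m + j < size p + size q)%N.
  by rewrite -addSn leq_add // ?(leq_ltn_trans (leq_subr _ _)) // ltnW.
rewrite (bigD1 (Ordinal lt)) //= eqxx big1 ?addr0.
  by rewrite iterD mulrnAl mulrnAr mulrA.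
by move=> k; rewrite -val_eqE /= eq_sym => /negbTE ->; rewrite mul0r.
Qed.

Lemma action_opexp p k u : action (opexp d p k) u = iter k (action p) u.
Proof.
elim: k => [|k IH]; first by rewrite /action /= big_ord1 /= mul1r.
by rewrite /opexp iterS action_opmul -/(opexp d p k) IH.
Qed.

Lemma action_const x u : action [:: x] u = x * u.
Proof. by rewrite /action big_ord1. Qed.

Lemma size_opexp_nabla n a k : (size (opexp d (nabla n a) k) <= k.*2.+1)%N.
Proof.
elim: k => [//|k IH]; rewrite /opexp iterS -/(opexp d (nabla n a) k) size_mkseq /=.
by rewrite doubleS.
Qed.

Lemma action_nabla n a u : action (nabla n a) u = coef n a 1 * u + d u.
Proof. by rewrite /action !big_ord_recl big_ord0 /= addr0 mul1r. Qed.

Lemma action_opL n a u : action (opL n a) u = ((coef n a : hurwitz R) * taylor d u) n.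
Proof.
rewrite /action size_mkseq hurwitz_mulE (reindex_inj rev_ord_inj) /=.
apply: eq_bigr => i _; have lin : (i <= n)%N by rewrite -ltnS.
by rewrite subSS nth_mkseq ?ltnS ?leq_subr // subKn // mulrnAl.
Qed.

Lemma action_spec n I a u : invariants_spec n I ->
  ((coef n a : hurwitz R) * taylor d u) n =
    iter n (action (nabla n a)) u +
    \sum_(2 <= j < n.+1)
      (deval d n a (I j) * iter (n - j) (action (nabla n a)) u) *+ 'C(n, j).
Proof.
move=> HI; rewrite -action_opL.
(* 2n + 2 bounds the lengths of all operators involved, including the trailing zeros left by
   [opmul]. *)
rewrite (@actionE n.*2.+2); last by rewrite size_mkseq ltnS leqW // -addnn leq_addr.
under eq_bigr do rewrite (HI _ _ Hd) mulrDl big_distrl /=.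
rewrite big_split exchange_big /=; congr (_ + _).
  by rewrite -action_opexp (@actionE n.*2.+2) // leqW // size_opexp_nabla.
apply: eq_bigr => j _; rewrite -actionE; last first.
  rewrite size_mkseq /= add1n ltnS (leq_trans (size_opexp_nabla _ _ _)) // ltnS.
  by rewrite leq_double leq_subr.
by rewrite action_opmul action_const action_opexp mulrnAl.
Qed.

(** L is applied to f w with f killed by nabla: nabla^k(f w) = f D^k(w) and taylor(f) = P f. Both
    sides become combinations of the D^(n-j)(w), ready for comparison of coefficients. *)
Lemma gauged_spec n I a f w : invariants_spec n I ->
  d f = - (coef n a 1 * f) ->
  \sum_(j < n.+1)
     (((coef n a : hurwitz R) * pseq d (coef n a 1)) j * f * iter (n - j) d w)
       *+ 'C(n, j) =
  f * iter n d w +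
  \sum_(2 <= j < n.+1)
     (deval d n a (I j) * (f * iter (n - j) d w)) *+ 'C(n, j).
Proof.
move=> HI df.
have nab k : iter k (action (nabla n a)) (f * w) = f * iter k d w.
  elim: k => //= k ->; rewrite action_nabla (derM Hd) df mulNr !mulrA addrA subrr.
  by rewrite add0r.
have := action_spec a (f * w) HI.
rewrite nab taylorM // (taylor_pseq Hd df) !mulrA hurwitz_mulE.
under eq_bigr do rewrite hurwitzM mul_hconstE.
by move=> ->; congr (_ + _); apply: eq_bigr => j _; rewrite nab.
Qed.

End OperatorAction.

(** Writes the conventions of [coef] into the expression, so that the remaining symbols can be
    evaluated freely. *)
Definition nsymbol (n : nat) (v : nat * nat) : dpoly :=
  if v.1 == 0%N then (if v.2 == 0%N then N1 else N0)
  else if (v.1 <= n)%N then NVar v else N0.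

Lemma deval_nsymbol (R : pzRingType) (d : R -> R) n a C : is_derivation d ->
  deval d n a C = neval (fun v => iter v.2 d (a v.1)) (nsubst (nsymbol n) C).
Proof.
move=> Hd; rewrite neval_nsubst; apply: eq_neval => -[i m] /=.
rewrite /coef /nsymbol /=; case: eqP => _; first by rewrite iter_der1 //; case: m.
by case: leqP => // _; rewrite iter_der0.
Qed.

Lemma neval_head (V : Type) (R : pzRingType) (env : V -> hurwitz R) (e : ncexpr V) :
  (neval env e) 0%N = neval (fun v => env v 0%N) e.
Proof. by elim: e => //= [? <- ? <-|? <-|? <- ? <-]. Qed.

Lemma invariants_canonical n I j : invariants_spec n I -> (2 <= j <= n)%N ->
  forall (R : pzRingType) (d : R -> R), is_derivation d ->
  forall a : nat -> R, deval d n a (I j) = deval d n a (canonical_inv j).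
Proof.
move=> HI /andP[j2 jn] R d Hd a.
pose S := ncseries (nat * nat)%type.
(* The m-th shift of [X i] has as head the free variable (i, m), so heads of evaluations are
   universal. *)
pose X i : hurwitz S := fun m => ncvar (i, m).
have sD := @shift_derivation S.
have gen e : deval (@shift S) n X e 0%N = neval (@ncvar _) (nsubst (nsymbol n) e).
  rewrite (deval_nsymbol _ _ _ sD) neval_head; apply: eq_neval => -[i m] /=.
  by rewrite iter_shiftE.
have key : deval (@shift S) n X (I j) 0%N = deval (@shift S) n X (canonical_inv j) 0%N.
  have [f [f0 df]] := hurwitz_gauge (coef n X 1).
  (* For i <= n the head of D^(n-i)(w) is 1 if i = j and 0 otherwise, which isolates the j-th
     terms. *)
  pose w : hurwitz S := fun k => (k == n - j)%N%:R.
  have := congr1 (fun u : hurwitz S => u 0%N) (gauged_spec sD w HI df).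
  have w0 i : (i < n.+1)%N -> iter (n - i) (@shift S) w 0%N = (i == j)%:R.
    move=> ilt; rewrite iter_shiftE add0n /w; congr (_%:R : S).
    by congr nat_of_bool; apply/eqP/eqP=> [|->//]; move: ilt; lia.
  have lhs (i : 'I_n.+1) : true ->
    ((((coef n X : hurwitz (hurwitz S)) * pseq (@shift S) (coef n X 1)) i * f *
      iter (n - i) (@shift S) w) *+ 'C(n, i)) 0%N =
      if (i : nat) == j then deval (@shift S) n X (canonical_inv j) 0%N *+ 'C(n, j) else 0.
    move=> _; rewrite hurwitzMn hurwitzM0 [(_ * f) 0%N]hurwitzM0 f0 mulr1 w0 //.
    by case: eqP => [->|_]; rewrite ?mulr1 ?mulr0 ?mul0rn // deval_canonical.
  have rhs i : (2 <= i < n.+1)%N ->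
    ((deval (@shift S) n X (I i) * (f * iter (n - i) (@shift S) w)) *+ 'C(n, i)) 0%N =
      if i == j then deval (@shift S) n X (I j) 0%N *+ 'C(n, j) else 0.
    move=> /andP[_ ilt]; rewrite hurwitzMn hurwitzM0 [(f * _) 0%N]hurwitzM0 f0 mul1r w0 //.
    by case: eqP => [->|_]; rewrite ?mulr1 ?mulr0 ?mul0rn.
  rewrite hurwitz_sum (eq_bigr _ lhs) hurwitzD hurwitz_sum (eq_big_nat _ _ rhs).
  rewrite -(big_mkord xpredT (fun i => if i == j then deval (@shift S) n X (canonical_inv j) 0%N *+ 'C(n, j) else 0)) -!big_mkcond.
  rewrite !big_nat1_eq ltnS jn j2 leq0n /= hurwitzM0 f0 mul1r.
  (* The leading term f D^n(w) has head 0, because j >= 2. *)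
  have := w0 0%N isT; rewrite subn0 => ->.
  have -> : (0%N == j) = false by case: j j2 {jn lhs rhs w w0}.
  rewrite add0r => h; apply/esym/eqP; rewrite -subr_eq0; apply/eqP.
  apply: (@ncseries_torsion_free _ _ 'C(n, j)); first by rewrite bin_gt0.
  by rewrite mulrnBl h subrr.
have := @ncvar_identity _ (NAdd (nsubst (nsymbol n) (I j))
   (NOpp (nsubst (nsymbol n) (canonical_inv j)))) R (fun v => iter v.2 d (a v.1)).
rewrite /= -!gen key subrr -!deval_nsymbol // => /(_ erefl) /eqP.
by rewrite subr_eq0 => /eqP.
Qed.

(** * Polynomials in the invariants: covariance and normal form *)

Section Invariants.
Context (n : nat) (I : nat -> dpoly) (HI : invariants_spec n I).
Context (R : pzRingType) (d : R -> R) (Hd : is_derivation d).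
Implicit Types (a : nat -> R) (f g : R) (Q : ncexpr (nat * nat)).

(** Conjugation respects the ring operations, so only the symbols matter: [canonical_covariant]
    settles m = 0 and [Delta_covariant] raises m. *)
Lemma poly_in_invariants_covariant a f g Q : (0 < n)%N -> f * g = 1 -> g * f = 1 ->
  deval d n (gauge d n f g a) (poly_in_invariants n I Q)
    = g * deval d n a (poly_in_invariants n I Q) * f.
Proof.
move=> n0 fg gf; rewrite /deval !neval_nsubst -neval_conj //.
apply: eq_neval => -[i m]; rewrite /inv_symbol /=.
case: ifP => [ij|_] /=; last by rewrite mulr0 mul0r.
rewrite -![neval _ _]/(deval d n _ _).
elim: m => [|m IH] /=; last exact: Delta_covariant.
rewrite !(invariants_canonical HI ij Hd); apply: canonical_covariant => //.
by case/andP: ij.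
Qed.

(** With a_1 = 0 the sequence P is 1, hence I_k = a_k for k >= 2, and [Delta] evaluates as d. The
    symbols of index 1 become [N0], in agreement with a_1 = 0. *)
Lemma deval_invariants_normalized a C : coef n a 1 = 0 ->
  deval d n a C = deval d n a (poly_in_invariants n I (nsubst (nsymbol n) C)).
Proof.
move=> a1; rewrite /deval !neval_nsubst; apply: eq_neval => -[i m] /=.
rewrite /nsymbol /=.
case: i => [|i] /=; first by rewrite iter_der1 //; case: m.
rewrite [in LHS]/coef /=; case: ifP => [lin|_]; last by rewrite iter_der0.
rewrite /= -[neval _ _]/(deval d n a _) /inv_symbol /=.
have Delta_der e : deval d n a (Delta e) = d (deval d n a e).
  by rewrite deval_Delta // a1 mul0r mulr0 subrr addr0.
case: i lin => [|i] lin /=.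
  by move: a1; rewrite /coef /= lin => ->; rewrite /deval /= iter_der0.
rewrite lin /=.
elim: m => [|m IH] /=; last by rewrite Delta_der -IH.
rewrite (invariants_canonical HI _ Hd) ?lin // deval_canonical // a1 pseq0 // mulr1.
by rewrite /coef /= lin.
Qed.

End Invariants.

(** * The Taylor embedding and the final comparison *)

Section TaylorMorphism.
Context (R : pzRingType) (d : R -> R) (Hd : is_derivation d).

Fact taylor_monoid_morphism : monoid_morphism (taylor d : R -> hurwitz R).
Proof. by split; [exact: taylor1 | exact: taylorM]. Qed.

Fact taylor_zmod_morphism : zmod_morphism (taylor d : R -> hurwitz R).
Proof. exact: taylorB. Qed.

Definition taylor_rmorphism : {rmorphism R -> hurwitz R} :=
  HB.pack (taylor d : R -> hurwitz R)
    (GRing.isZmodMorphism.Build R (hurwitz R) (taylor d) taylor_zmod_morphism)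
    (GRing.isMonoidMorphism.Build R (hurwitz R) (taylor d) taylor_monoid_morphism).

Lemma taylor_injective : injective taylor_rmorphism.
Proof. by move=> x y /(congr1 (fun u : hurwitz R => u 0%N)). Qed.

End TaylorMorphism.

Lemma deval_rmorphism (K E : pzRingType) (D : K -> K) (dE : E -> E)
    (h : {rmorphism K -> E}) n a C : (forall x, dE (h x) = h (D x)) ->
  deval dE n (h \o a) C = h (deval D n a C).
Proof.
move=> hD; rewrite /deval neval_rmorph; apply: eq_neval => -[i m] /=.
elim: m => [|m IH] /=; last by rewrite IH hD.
by rewrite /coef; do 2?case: ifP => _; rewrite ?rmorph1 ?rmorph0.
Qed.

Theorem mainTheorem7 (K : pzRingType) (D : K -> K) (HD : is_derivation D)
  (n : nat) (hn : (2 <= n)%N) (I : nat -> dpoly) (HI : invariants_spec n I) :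
  (forall Q : ncexpr (nat * nat),
     gauge_covariant D n (poly_in_invariants n I Q)) /\
  (forall C : dpoly, gauge_covariant D n C ->
     exists Q : ncexpr (nat * nat),
       forall a : nat -> K,
         deval D n a C = deval D n a (poly_in_invariants n I Q)).
Proof.
have n0 : (0 < n)%N by apply: ltnW.
split=> [Q E dE h _ HdE _ f g fg gf a|C covC].
  exact: poly_in_invariants_covariant.
exists (nsubst (nsymbol n) C) => a.
set Q := nsubst _ C; pose h := taylor_rmorphism HD.
have sD := @shift_derivation K.
have hD x : shift (h x) = h (D x) by apply: shift_taylor.
have [f [f0 df]] := hurwitz_gauge (coef n (h \o a) 1).
have [g [fg gf]] := hurwitz_gauge_inv f0 df.
have conjK (x : hurwitz K) : f * (g * x * f) * g = x.
  by rewrite !mulrA fg mul1r -mulrA fg mulr1.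
have covI := poly_in_invariants_covariant HI sD (h \o a) Q n0 fg gf.
have b1 : coef n (gauge (@shift K) n f g (h \o a)) 1 = 0.
  by rewrite coef1_gauge // df mulrN mulrA addNr.
(* The two values are compared inside [hurwitz K]: each is conjugated to its value at the gauged
   operator, where they agree, and the conjugation is then undone. *)
apply: (taylor_injective (Hd := HD)); rewrite -/h -!(deval_rmorphism _ _ _ hD).
rewrite -[LHS]conjK -(covC _ _ h (taylor_injective (Hd := HD)) sD hD f g fg gf a).
by rewrite (deval_invariants_normalized HI sD C b1) covI conjK.
Qed.
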